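(* Let $F$ be a polynomial Euler product (as defined in the context) such that the series $\sum_{n=1}^\infty \alpha(n)/n$ converges. Then for every real $x\ge 1$, $$E_2(x,F) = x\,f_1(x,F) + \tfrac12\,g_1(x,F).$$
   Context: A polynomial Euler product is a function $F(s)$ of a complex variable $s=\sigma+it$, defined for $\sigma>1$ by $F(s)=\prod_p F_p(s)=\prod_p\prod_{j=1}^d\left(1-\frac{\alpha_j(p)}{p^s}\right)^{-1}$, where $p$ runs over primes, $\alpha_j(p)\in\mathbb{C}$ with $|\alpha_j(p)|\le 1$ for all $p$ and $1\le j\le d$, and $d$ (the Euler degree) is minimal, i.e. there is a prime $p_0$ with $\prod_{j=1}^d\alpha_j(p_0)\neq 0$. In particular $F_p(1)=\prod_{j=1}^d(1-\alpha_j(p)/p)^{-1}$. The associated Euler totient function is $\varphi(n,F)=n\prod_{p\mid n}F_p(1)^{-1}$ for $n\in\mathbb{N}$. Put $\gamma(p)=p\left(1-\frac{1}{F_p(1)}\right)$, $C(F)=\frac12\prod_p\left(1-\frac{\gamma(p)}{p^2}\right)$, and $\alpha(n)=\mu(n)\prod_{p\mid n}\gamma(p)$, where $\mu$ is the Möbius function. For real $x\ge0$ let $E(x,F)=\sum_{n\le x}\varphi(n,F)-C(F)x^2$, and let $E_2(x,F)=E(x,F)$ if $x\notin\mathbb{N}$, and $E_2(x,F)=\frac12\big(E(x-0,F)+E(x+0,F)\big)$ otherwise (one-sided limits). Let $s(x)=0$ if $x\in\mathbb{Z}$ and $s(x)=\frac12-\{x\}$ otherwise, where $\{x\}=x-[x]$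 is the fractional part. Define, for $x\ge0$, $f_1(x,F)=\sum_{n=1}^\infty\frac{\alpha(n)}{n}\,s\!\left(\frac{x}{n}\right)$ and $g_1(x,F)=\sum_{n=1}^\infty\alpha(n)\left\{\frac{x}{n}\right\}\left(\left\{\frac{x}{n}\right\}-1\right)$. *)

(* Defs.v *)
From HB Require Import structures.
From mathcomp Require Import all_boot all_order all_algebra.
From mathcomp Require Import all_classical all_reals all_analysis.
From mathcomp Require Import complex.

Set Implicit Arguments.
Unset Strict Implicit.
Unset Printing Implicit Defensive.

Import Order.TTheory GRing.Theory Num.Theory numFieldNormedType.Exports.

Local Open Scope ring_scope.
Local Open Scope classical_set_scope.
Local Open Scope complex_scope.

(* MathComp-Analysis puts the topology of the norm on the regular algebra
   R[i]^o, which is convertible to R[i]; all limits are taken there. *)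
Definition ccvgn (R : realType) (u : nat -> R[i]) : Prop :=
  cvgn (u : nat -> R[i]^o).

Definition climn (R : realType) (u : nat -> R[i]) : R[i] :=
  limn (u : nat -> R[i]^o).

Definition lim_left (R : realType) (f : R -> R[i]) (x : R) : R[i] :=
  lim ((f : R -> R[i]^o) y @[y --> x^'-]).

Definition lim_right (R : realType) (f : R -> R[i]) (x : R) : R[i] :=
  lim ((f : R -> R[i]^o) y @[y --> x^'+]).

Definition psum (R : realType) (u : nat -> R[i]) (N : nat) : R[i] :=
  \sum_(1 <= n < N.+1) u n.

Definition pprod (R : realType) (u : nat -> R[i]) (N : nat) : R[i] :=
  \prod_(1 <= p < N.+1 | prime p) u p.

(* n ^ s = exp (s log n), for n > 0 *)
Definition natcpow (R : realType) (n : nat) (s : R[i]) : R[i] :=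
  (expR (complex.Re s * ln n%:R))%:C *
  (cos (complex.Im s * ln n%:R) +i* sin (complex.Im s * ln n%:R)).

(* The values of the coefficients at non-primes are irrelevant. *)
Record polyEulerProduct (R : realType) := PolyEulerProduct {
  euler_degree : nat;
  euler_coef : 'I_euler_degree -> nat -> R[i];
  euler_coef_le1 : forall j p, prime p -> `|euler_coef j p| <= 1;
  euler_degree_min :
    exists2 p0, prime p0 & \prod_(j < euler_degree) euler_coef j p0 != 0
}.

Section EulerTotient.
Variables (R : realType) (F : polyEulerProduct R).

Definition euler_factor (p : nat) (s : R[i]) : R[i] :=
  \prod_(j < euler_degree F) (1 - euler_coef j p / natcpow p s)^-1.

(* The function F(s) itself, meaningful for Re s > 1. *)
Definition euler_function (s : R[i]) : R[i] :=
  climn (pprod (fun p => euler_factor p s)).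

Definition euler_totient (n : nat) : R[i] :=
  n%:R * \prod_(p <- primes n) (euler_factor p 1)^-1.

Definition euler_gamma (p : nat) : R[i] :=
  p%:R * (1 - (euler_factor p 1)^-1).

Definition euler_C_factor (p : nat) : R[i] := 1 - euler_gamma p / p%:R ^+ 2.

Definition euler_C : R[i] := 2^-1 * climn (pprod euler_C_factor).

(* primes n lists each prime divisor of n > 0 once; moebius 0 is irrelevant. *)
Definition moebius (n : nat) : int :=
  if all (fun p => logn p n == 1%N) (primes n) then (-1) ^+ size (primes n)
  else 0.

Definition euler_alpha (n : nat) : R[i] :=
  (moebius n)%:~R * \prod_(p <- primes n) euler_gamma p.

Definition euler_E (x : R) : R[i] :=
  \sum_(1 <= n < (Num.truncn x).+1) euler_totient n - euler_C * x%:C ^+ 2.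

Definition euler_E2 (x : R) : R[i] :=
  if x \is a Num.nat then 2^-1 * (lim_left euler_E x + lim_right euler_E x)
  else euler_E x.

Definition frac_part (x : R) : R := x - (Num.floor x)%:~R.

Definition sawtooth (x : R) : R :=
  if x \is a Num.int then 0 else 2^-1 - frac_part x.

Definition f1_term (x : R) (n : nat) : R[i] :=
  euler_alpha n / n%:R * (sawtooth (x / n%:R))%:C.

Definition euler_f1 (x : R) : R[i] := climn (psum (f1_term x)).

Definition g1_term (x : R) (n : nat) : R[i] :=
  euler_alpha n * (frac_part (x / n%:R) * (frac_part (x / n%:R) - 1))%:C.

Definition euler_g1 (x : R) : R[i] := climn (psum (g1_term x)).

Lemma euler_factor1 (p : nat) : prime p ->
  euler_factor p 1 =
  \prod_(j < euler_degree F) (1 - euler_coef j p / p%:R)^-1.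
Proof.
move=> /prime_gt0 p_gt0; apply: eq_bigr => j _; congr (1 - _ / _)^-1.
rewrite /natcpow /= mul0r mul1r cos0 sin0 lnK ?posrE ?ltr0n//.
by rewrite -[1 +i* 0]/(1 : R[i]) mulr1 rmorph_nat.
Qed.

Lemma continuous_real_complex : continuous (real_complex R : R -> R[i]^o).
Proof.
move=> x; apply/cvgrPdist_lt => e e0.
move: e0; rewrite ltcE => /andP[/eqP/= Ime Ree].
near=> y.
have -> : `|(x%:C : R[i]^o) - y%:C| = `|x - y|%:C.
  by rewrite -rmorphB normc_def /= expr0n addr0 sqrtr_sqr.
rewrite ltcE /= -Ime eqxx /=.
near: y; move/cvgrPdist_lt: (@cvg_id _ (nbhs x)); exact.
Unshelve. all: by end_near. Qed.

Lemma euler_E_near_cvg (G : set_system R) {FG : ProperFilter G} (x : R) (m : nat) :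
  G `=>` nbhs x -> (\forall y \near G, Num.truncn y = m) ->
  cvg ((euler_E : R -> R[i]^o) y @[y --> G]).
Proof.
move=> Gx Gm; apply/cvg_ex.
exists (\sum_(1 <= n < m.+1) euler_totient n - euler_C * x%:C ^+ 2 : R[i]^o).
have h : ((\sum_(1 <= n < m.+1) euler_totient n - euler_C * y%:C ^+ 2 : R[i]^o)
    @[y --> G]) --> (\sum_(1 <= n < m.+1) euler_totient n - euler_C * x%:C ^+ 2 : R[i]^o).
  apply: cvg_trans (cvg_app _ Gx) _.
  apply: cvgB; first exact: cvg_cst.
  apply: cvgM; first exact: cvg_cst.
  by apply: cvgM; exact: continuous_real_complex.
apply: cvg_trans h; apply: near_eq_cvg.
by apply: filterS Gm => y; rewrite /euler_E => ->.
Qed.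

(* The one-sided limits in euler_E2 exist at every positive integer. *)
Lemma euler_E_is_cvg_left (m : nat) :
  cvg ((euler_E : R -> R[i]^o) y @[y --> (m.+1%:R : R)^'-]).
Proof.
apply: (@euler_E_near_cvg _ _ m.+1%:R m); first exact: cvg_within.
near=> y; apply/eqP; rewrite truncn_eq.
  apply/andP; split; near: y; last exact: nbhs_left_lt.
  by apply: nbhs_left_ge; rewrite ltr_nat.
by near: y; apply: nbhs_left_ge; rewrite ltr0n.
Unshelve. all: by end_near. Qed.

Lemma euler_E_is_cvg_right (m : nat) :
  cvg ((euler_E : R -> R[i]^o) y @[y --> (m%:R : R)^'+]).
Proof.
apply: (@euler_E_near_cvg _ _ m%:R m); first exact: cvg_within.
near=> y; apply/eqP; rewrite truncn_eq.
  apply/andP; split; near: y; first exact: nbhs_right_ge.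
  by apply: nbhs_right_lt; rewrite ltr_nat.
near: y; apply: filterS (nbhs_right_ge _) => y; exact: le_trans.
Unshelve. all: by end_near. Qed.

End EulerTotient.

(* Main.v *)
Require Import Defs.
From HB Require Import structures.
From mathcomp Require Import all_boot all_order all_algebra.
From mathcomp Require Import all_classical all_reals all_analysis.
From mathcomp Require Import complex.
From mathcomp Require Import ring.

(* Expanding the Euler products gives phi(n, F) = sum_{d | n} alpha(d) n / d, so
   that sum_{n <= x} phi(n, F) = sum_d alpha(d) [x/d] ([x/d] + 1) / 2.  With
   u = x/d,
     [u] ([u] + 1) / 2 = u^2 / 2 + u (1/2 - {u}) + {u} ({u} - 1) / 2,
   and both sides vanish for d > x, so the sum over d may be cut at any N >= x.
   The three terms are the partial sums of (x^2 / 2) sum alpha(d) / d^2, of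
   x f1 and of g1 / 2; the value s = 0 instead of 1/2 at integers accounts for
   the term phi(x, F) / 2 that E2 removes from E when x is an integer.  Since
   gamma is bounded, sum alpha(d) / d^2 converges absolutely, and its sum is the
   product 2 C(F). *)

Set Implicit Arguments.
Unset Strict Implicit.
Unset Printing Implicit Defensive.

Import Order.TTheory GRing.Theory Num.Theory numFieldNormedType.Exports.

Local Open Scope ring_scope.
Local Open Scope complex_scope.

(** * Expansion of products over primes *)

(** This is the test inside [moebius], so that it can be folded there. It also holds at 0, whose
    list of primes is empty; hence the positivity hypotheses below. *)
Definition squarefree (n : nat) : bool :=
  all (fun p => logn p n == 1)%N (primes n).

Lemma squarefree_prod_primes (n : nat) : (0 < n)%N -> squarefree n ->
  (\prod_(p <- primes n) p)%N = n.
Proof.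
move=> n0 /allP sq; rewrite [RHS](prod_prime_decomp n0) prime_decompE big_map /=.
by apply: eq_big_seq => q qn; rewrite (eqP (sq _ qn)) expn1.
Qed.

(** Products of the sublists of [s]. The two halves omit or take the factor [p], just as multiplying
    out picks 1 or [h p] from each factor [1 + h p]. *)
Fixpoint subproducts (s : seq nat) : seq nat :=
  if s is p :: s' then subproducts s' ++ [seq (p * d)%N | d <- subproducts s']
  else [:: 1%N].

Lemma perm_primes_mulp (p d : nat) : prime p -> (0 < d)%N -> p \notin primes d ->
  perm_eq (primes (p * d)) (p :: primes d).
Proof.
move=> pp d0 pd; apply: uniq_perm; rewrite ?primes_uniq//=.
  by rewrite pd primes_uniq.
by move=> q; rewrite primesM ?(prime_gt0 pp)// primes_prime// !inE.
Qed.

(** A squarefree [d] is either prime to the head [p] or of the form [p * e] with [e] squarefree and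
    prime to [p]; these cases match the two halves of the list. *)
Lemma mem_subproducts (s : seq nat) : uniq s -> all prime s -> forall d,
  (d \in subproducts s) =
  [&& (0 < d)%N, squarefree d & all (mem s) (primes d)].
Proof.
elim: s => [_ _ d|p s IH /= /andP[ps us] /andP[pp As] d].
  rewrite inE; apply/eqP/and3P => [->//|[d0 _]].
  have [d1|d1 _] := ltnP 1 d; last by apply/eqP; rewrite eqn_leq d1.
  by move=> /allP/(_ (pdiv d)); rewrite mem_primes pdiv_prime// d0 pdiv_dvd => /(_ isT).
rewrite mem_cat IH//; apply/orP/idP.
  case=> [/and3P[-> -> /allP H]|/mapP[e]].
    by apply/allP => q /H; rewrite !inE => ->; rewrite orbT.
  rewrite IH// => /and3P[e0 /allP sq /allP sm] ->.
  have pe : p \notin primes e by apply/negP => /sm; apply/negP.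
  have := perm_primes_mulp pp e0 pe => /perm_mem prs.
  rewrite muln_gt0 (prime_gt0 pp)//= e0/=; apply/andP; split; apply/allP => q;
    rewrite prs !inE => /orP[/eqP->|qe].
  - rewrite lognM ?(prime_gt0 pp)// (logn_prime _ pp) eqxx.
    by move: pe; rewrite -logn_gt0 -eqn0Ngt => /eqP->.
  - rewrite lognM ?(prime_gt0 pp)// (eqP (sq _ qe)) (logn_prime _ pp).
    by case: (eqVneq q p) qe => // ->; rewrite (negPf pe).
  - by rewrite eqxx.
  - by have := sm _ qe; rewrite inE => ->; rewrite orbT.
move=> /and3P[d0 /allP sq /allP sm].
case: (boolP (p \in primes d)) => [pd|pd]; last first.
  left; rewrite d0/=; apply/andP; split; first exact/allP.
  apply/allP => q qd; move: (sm _ qd); rewrite !inE.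
  by case: (eqVneq q p) qd => // ->; rewrite (negPf pd).
right; move: (pd); rewrite mem_primes => /and3P[_ _ /dvdnP[e de]].
have e0 : (0 < e)%N by move: d0; rewrite de muln_gt0 => /andP[].
have pe : p \notin primes e.
  have /eqP := sq _ pd; rewrite de lognM ?(prime_gt0 pp)// (logn_prime p pp) eqxx.
  by rewrite -logn_gt0 -eqn0Ngt addn1 => -[->].
apply/mapP; exists e; last by rewrite mulnC.
have := perm_primes_mulp pp e0 pe => /perm_mem.
rewrite mulnC -de => prs.
rewrite IH// e0/=; apply/andP; split; apply/allP => q qe.
  have qd : q \in primes d by rewrite prs inE qe orbT.
  have /eqP := sq _ qd; rewrite de lognM ?(prime_gt0 pp)// (logn_prime _ pp).
  case: (eqVneq q p) => [qp|_ ]; last by rewrite addn0 => ->.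
  by move: pe; rewrite -qp qe.
have qd : q \in primes d by rewrite prs inE qe orbT.
have := sm _ qd; rewrite !inE; case: (eqVneq q p) qe => // ->.
by rewrite (negPf pe).
Qed.

Lemma uniq_subproducts (s : seq nat) : uniq s -> all prime s ->
  uniq (subproducts s).
Proof.
elim: s => //= p s IH /andP[ps us] /andP[pp As].
rewrite cat_uniq IH//= map_inj_uniq ?IH// ?andbT; last first.
  by move=> a b /eqP; rewrite eqn_pmul2l ?(prime_gt0 pp)// => /eqP.
apply/hasPn => _ /mapP[e + ->] /=; rewrite !mem_subproducts//.
move=> /and3P[e0 _ _]; apply/negP => /and3P[_ _ /allP/(_ p)].
by rewrite primesM ?(prime_gt0 pp)// primes_prime// !inE eqxx /= (negPf ps) => /(_ isT).
Qed.

Lemma prod_1D (A : comNzRingType) (h : nat -> A) (s : seq nat) :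
  uniq s -> all prime s ->
  \prod_(p <- s) (1 + h p) =
  \sum_(d <- subproducts s) \prod_(p <- primes d) h p.
Proof.
elim: s => [|p s IH] /= => [_ _|/andP[ps us] /andP[pp As]].
  by rewrite big_nil big_seq1 big_nil.
rewrite big_cons big_cat big_map /= IH// mulrDl mul1r big_distrr/=; congr (_ + _).
apply: eq_big_seq => d; rewrite mem_subproducts// => /and3P[d0 _ /allP sm].
have pd : p \notin primes d by apply/negP => /sm; apply/negP.
by rewrite (perm_big _ (perm_primes_mulp pp d0 pd)) big_cons.
Qed.

(** Indexing by an interval lets sums be exchanged and compared later. No term is lost: a squarefree
    [d] with all its primes in [s] divides the product of [s], so it is at most [M]. *)
Lemma prod_1D_range (A : comNzRingType) (h : nat -> A) (s : seq nat) (M : nat) :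
  uniq s -> all prime s -> (\prod_(p <- s) p <= M)%N ->
  \prod_(p <- s) (1 + h p) =
  \sum_(1 <= d < M.+1 | squarefree d && all (mem s) (primes d))
    \prod_(p <- primes d) h p.
Proof.
move=> us As sM; rewrite prod_1D// -[RHS]big_filter; apply: perm_big.
apply: uniq_perm; rewrite ?uniq_subproducts ?filter_uniq ?iota_uniq// => d.
rewrite mem_filter mem_subproducts// mem_index_iota ltnS andbC -andbA.
case: (boolP (squarefree d)) => //= sq; case: (boolP (all _ _)) => //= sm.
case: (posnP d) => // d0; rewrite /=; apply/esym.
apply: leq_trans sM.
rewrite -(squarefree_prod_primes d0 sq).
apply: dvdn_leq.
  by rewrite big_seq prodn_cond_gt0// => p /(allP As)/prime_gt0.
rewrite [X in (_ %| X)%N](bigID (fun p => p \in primes d))/=; apply: dvdn_mulr.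
rewrite -[X in (_ %| X)%N]big_filter; rewrite [X in (_ %| X)%N](perm_big (primes d)) ?dvdnn//=.
apply: uniq_perm; rewrite ?filter_uniq ?primes_uniq// => p.
rewrite mem_filter; case: (boolP (p \in primes d)) => //= pd.
exact: (allP sm).
Qed.

(** * Arithmetic of [euler_alpha] *)

Lemma squarefree_dvdn (d n : nat) : (0 < d)%N -> (0 < n)%N -> squarefree d ->
  all (mem (primes n)) (primes d) = (d %| n)%N.
Proof.
move=> d0 n0 /allP sq; apply/idP/idP => [/allP sd|dn]; last first.
  by apply/allP => p; rewrite inE !mem_primes d0 n0 /= => /andP[-> /dvdn_trans]; exact.
apply/dvdn_partP => // p; rewrite inE /= => pd.
by rewrite p_part (eqP (sq _ pd)) expn1; move: (sd _ pd); rewrite inE mem_primes => /and3P[].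
Qed.

Lemma leq_prod_primes (n : nat) : (0 < n)%N -> (\prod_(p <- primes n) p <= n)%N.
Proof.
move=> n0; rewrite [leqRHS](prod_prime_decomp n0) prime_decompE big_map /=.
rewrite big_seq [leqRHS]big_seq; apply: leq_prod => p pn.
by rewrite -[leqLHS]expn1 leq_pexp2l ?logn_gt0// prime_gt0//;
  move: pn; rewrite mem_primes => /andP[].
Qed.

(** The sum is 1 + 2 + ... + [m/d], doubled to stay in [nat]. In the induction, [m/d] increases
    exactly when [m.+1] is a multiple of [d]. *)
Lemma sum_divn_multiples (d m : nat) : (0 < d)%N ->
  ((\sum_(1 <= n < m.+1 | d %| n) n %/ d) * 2 = (m %/ d) * (m %/ d).+1)%N.
Proof.
move=> d0; elim: m => [|m IH]; first by rewrite big_geq// div0n.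
rewrite big_mkcond big_nat_recr//= -big_mkcond mulnDl IH divnS//.
case: (d %| m.+1)%N; rewrite ?add0n ?add1n ?mul0n ?addn0 //; ring.
Qed.

Section Alpha.
Variables (R : realType) (F : polyEulerProduct R).

Lemma euler_alphaE (n : nat) : euler_alpha F n =
  if squarefree n then \prod_(p <- primes n) - euler_gamma F p else 0.
Proof.
rewrite /euler_alpha /moebius -/(squarefree n).
case: ifP => _; last by rewrite mul0r.
under [RHS]eq_bigr do rewrite -mulN1r.
by rewrite [RHS]big_split /= big_const_seq count_predT iter_mulr_1 rmorphXn/= rmorphN1.
Qed.

Lemma euler_alpha_prod (n k : nat) : (0 < n)%N -> squarefree n ->
  \prod_(p <- primes n) (- (euler_gamma F p / p%:R ^+ k)) = euler_alpha F n / n%:R ^+ k.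
Proof.
move=> n0 sq; rewrite euler_alphaE sq.
under eq_bigr do rewrite -mulNr.
by rewrite big_split /= prodfV prodrXl -natr_prod squarefree_prod_primes.
Qed.

(** Expand 1/F_p(1) = 1 - gamma(p)/p over the primes dividing [n]. The bound [N] is free so that all
    [n] share one range of [d]. *)
Lemma euler_totient_alpha (n N : nat) : (0 < n <= N)%N ->
  euler_totient F n =
  \sum_(1 <= d < N.+1 | (d %| n)%N) euler_alpha F d * (n %/ d)%:R.
Proof.
move=> /andP[n0 nN]; rewrite /euler_totient.
have -> : \prod_(p <- primes n) (euler_factor F p 1)^-1 =
    \prod_(p <- primes n) (1 + - (euler_gamma F p / p%:R ^+ 1)).
  apply: eq_big_seq => p; rewrite mem_primes => /andP[pp _].
  have p0 : p%:R != 0 :> R[i] by rewrite pnatr_eq0 -lt0n prime_gt0.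
  by rewrite /euler_gamma expr1 mulrAC mulfV// mul1r opprB addrCA subrr addr0.
rewrite (@prod_1D_range _ _ _ N) ?primes_uniq//; last 2 first.
- by apply/allP => p; rewrite mem_primes => /andP[].
- exact: leq_trans (leq_prod_primes n0) nN.
rewrite big_distrr/= big_mkcond [RHS]big_mkcond; apply: eq_big_nat => d /andP[d0 _].
case: (boolP (squarefree d)) => [sq|/negPf nsq] /=; last first.
  by rewrite euler_alphaE nsq mul0r if_same.
rewrite squarefree_dvdn//; case: ifP => // dn.
rewrite euler_alpha_prod// expr1 -{1}(divnK dn) natrM.
by rewrite mulrCA mulfK// pnatr_eq0 -lt0n.
Qed.

Lemma sum_euler_totient (m N : nat) : (m <= N)%N ->
  \sum_(1 <= n < m.+1) euler_totient F n =
  \sum_(1 <= d < N.+1)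
    euler_alpha F d * ((m %/ d)%:R * ((m %/ d)%:R + 1) / 2).
Proof.
move=> mN; under eq_big_nat => n /andP[n0 nm].
  rewrite (@euler_totient_alpha _ N); last by rewrite n0 (leq_trans _ mN).
  over.
rewrite (exchange_big_dep predT)//=; apply: eq_big_nat => d /andP[d0 _].
rewrite -big_distrr/= -natr_sum; congr (_ * _).
apply: (@mulIf _ 2); first by rewrite pnatr_eq0.
by rewrite divfK ?pnatr_eq0// -natrM sum_divn_multiples// natrM -natr1.
Qed.

(** Every [d] up to [N] has all its primes at most [N], so the smoothness condition survives only in
    the tail. [M] does not depend on [h]; it exceeds no more than it must the product of the primes
    up to [N]. *)
Lemma pprod_1D_range (N : nat) : exists2 M, (N <= M)%N &
  forall h : nat -> R[i], pprod (fun p => 1 + h p) N =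
    \sum_(1 <= d < N.+1 | squarefree d) \prod_(p <- primes d) h p +
    \sum_(N.+1 <= d < M.+1 | squarefree d && all (leq^~ N) (primes d))
      \prod_(p <- primes d) h p.
Proof.
pose s := [seq p <- index_iota 1 N.+1 | prime p].
have us : uniq s by rewrite filter_uniq ?iota_uniq.
have As : all prime s by rewrite filter_all.
have sE d : all (mem s) (primes d) = all (leq^~ N) (primes d).
  apply: eq_in_all => p; rewrite mem_primes => /andP[pp _].
  by rewrite inE mem_filter mem_index_iota ltnS pp prime_gt0.
pose M := maxn N (\prod_(p <- s) p); exists M => [|h]; first exact: leq_maxl.
rewrite /pprod -big_filter -/s (@prod_1D_range _ _ _ M) ?leq_maxr//.
rewrite (big_cat_nat (n := N.+1)) ?ltnS ?leq_maxl//=; congr (_ + _).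
  rewrite [LHS]big_nat_cond [RHS]big_nat_cond; apply: eq_bigl => d.
  case: (boolP (1 <= d < N.+1)%N) => //= /andP[d0 dN].
  case: (squarefree d) => //=; rewrite sE; apply/allP => p.
  by rewrite mem_primes => /and3P[_ _ pd]; apply: leq_trans (dvdn_leq d0 pd) dN.
by apply: eq_bigl => d; rewrite sE.
Qed.

Lemma pprod_C_factor_tail (N : nat) : exists2 M, (N <= M)%N &
  `|pprod (euler_C_factor F) N - psum (fun n => euler_alpha F n / n%:R ^+ 2) N|
    <= \sum_(N.+1 <= n < M.+1) `|euler_alpha F n / n%:R ^+ 2|.
Proof.
have [M NM prodE] := pprod_1D_range N; exists M => //.
rewrite [pprod _ _](prodE (fun p => - (euler_gamma F p / p%:R ^+ 2))).
rewrite [X in X + _ - _](_ : _ = psum (fun n => euler_alpha F n / n%:R ^+ 2) N).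
  rewrite addrAC subrr add0r; apply: le_trans (ler_norm_sum _ _ _) _.
  rewrite big_mkcond/= big_nat_cond [leRHS]big_nat_cond; apply: ler_sum => d.
  rewrite andbT => /andP[Nd _]; have d0 : (0 < d)%N by exact: leq_trans Nd.
  by case: ifP => // /andP[sq _]; rewrite euler_alpha_prod.
rewrite /psum big_mkcond; apply: eq_big_nat => d /andP[d0 _].
by case: ifP => sq; [rewrite euler_alpha_prod | rewrite euler_alphaE sq mul0r].
Qed.

Lemma psum_norm_alpha_le (N : nat) :
  psum (fun n => `|euler_alpha F n / n%:R ^+ 2|) N <=
  pprod (fun p => 1 + `|euler_gamma F p / p%:R ^+ 2|) N.
Proof.
have [M _ ->] := pprod_1D_range N; rewrite -[leLHS]addr0; apply: lerD; last first.
  by apply: sumr_ge0 => d _; apply: prodr_ge0 => p _.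
rewrite /psum [leRHS]big_mkcond le_eqVlt; apply/orP; left; apply/eqP.
apply: eq_big_nat => d /andP[d0 _]; case: ifP => sq; last first.
  by rewrite euler_alphaE sq mul0r normr0.
by rewrite -euler_alpha_prod// normr_prod; under eq_bigr do rewrite normrN.
Qed.

End Alpha.

(** * Absolute convergence *)

Section Convergence.
Local Open Scope classical_set_scope.

(** Multiplied out, the difference has 2^r - 1 monomials with [r] the number of factors, each of
    norm at most [t] because [t <= 1]. *)
Lemma norm_1Bprod_1B (K : numFieldType) (I : Type) (r : seq I) (z : I -> K) (t : K) :
  0 <= t <= 1 -> (forall i, `|z i| <= t) ->
  `|1 - \prod_(i <- r) (1 - z i)| <= (2 ^+ size r - 1) * t.
Proof.
move=> /andP[t0 t1] zt; elim: r => [|i r IH].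
  by rewrite big_nil subrr normr0 mulr_ge0//= expr0 subrr.
rewrite big_cons; set Q := \prod_(j <- r) _ in IH *.
have Q2 : `|Q| <= 2 ^+ size r.
  rewrite -[Q](subKr 1) (le_trans (ler_normB _ _))// normr1 -lerBrDl.
  apply: le_trans IH _; rewrite -[leRHS]mulr1 ler_wpM2l// subr_ge0.
  by rewrite exprn_ege1// ler1n.
have -> : 1 - (1 - z i) * Q = (1 - Q) + z i * Q by ring.
apply: le_trans (ler_normD _ _) _; rewrite normrM.
have -> : (2 ^+ size (i :: r) - 1) * t = (2 ^+ size r - 1) * t + t * 2 ^+ size r.
  by rewrite exprS; ring.
by apply: lerD => //; apply: ler_pM.
Qed.

Lemma sum_inv_sqr_le (R : realFieldType) (N : nat) :
  \sum_(1 <= n < N.+1) (n%:R ^+ 2)^-1 <= 2 :> R.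
Proof.
(* The sharper bound makes the induction work: 1/y^2 <= 2/y - 2/(y + 1) for y >= 1. *)
suff : \sum_(1 <= n < N.+1) (n%:R ^+ 2)^-1 <= 2 - 2 / N.+1%:R :> R.
  by move=> /le_trans; apply; rewrite gerBl divr_ge0.
elim: N => [|N IH]; first by rewrite big_geq// divr1 subrr.
rewrite big_nat_recr//=; apply: le_trans (lerD IH (lexx _)) _.
rewrite -subr_ge0 -[N.+2%:R]natr1; set y := N.+1%:R.
have y1 : 1 <= y :> R by rewrite ler1n.
have -> : 2 - 2 / (y + 1) - (2 - 2 / y + (y ^+ 2)^-1) = (y - 1) / (y ^+ 2 * (y + 1)).
  by field; rewrite !gt_eqF// ?(lt_le_trans _ y1)// addr_gt0// (lt_le_trans _ y1).
by rewrite divr_ge0 ?subr_ge0// mulr_ge0 ?sqr_ge0// addr_ge0// (le_trans _ y1).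
Qed.

Section AbsoluteConvergence.
Variable R : realType.

Lemma bounded_normed_series_cvg (v : nat -> R) (B : R) :
  (forall N, \sum_(0 <= k < N) `|v k| <= B) -> cvgn (series v).
Proof.
move=> vB; apply: (@normed_cvg _ R^o); apply: nondecreasing_is_cvgn.
  by apply: nondecreasing_series => n _ _; exact: normr_ge0.
by exists B => _ [N _ <-]; exact: vB.
Qed.

Lemma psum_series (V : nat -> R[i]) : psum V = series (fun n => V n.+1).
Proof. by apply/funext => N; rewrite /psum /series/= big_add1. Qed.

(** Real and imaginary parts are dominated by the modulus, so both real series converge absolutely
    and can be recombined. *)
Lemma bounded_psum_norm_cvg (u : nat -> R[i]) (B : R) :
  (forall N, psum (fun n => `|u n|) N <= B%:C) -> ccvgn (psum u).
Proof.
move=> uB.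
have part (f : R[i] -> R) : (forall z, `|f z|%:C <= `|z|) ->
    cvgn (series (fun n => f (u n.+1))).
  move=> fz; apply: (@bounded_normed_series_cvg _ B) => N.
  rewrite -lecR; apply: le_trans (uB N).
  rewrite psum_series /series/= raddf_sum/=; apply: ler_sum => n _; exact: fz.
have cRe := part _ (@normc_ge_Re _).
have cIm : cvgn (series (fun n => complex.Im (u n.+1))).
  (* Multiplication by i preserves the modulus and turns the imaginary part, up to sign, into a real
     part. *)
  apply: part => z; have := normc_ge_Re (z * 'i%C).
  by rewrite ReiNIm normrN normrM [`|'i%C|]normc_def /= expr0n expr1n add0r sqrtr1 mulr1.
have lift (v : nat -> R) : cvgn v -> cvgn ((fun n => (v n)%:C) : nat -> R[i]^o).
  move=> cv; apply/cvg_ex; exists ((limn v)%:C).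
  apply: (@continuous_cvg _ _ _ _ _ v
    (fun t : R => (real_complex R t : R[i]^o)) (limn v) _ cv).
  exact: continuous_real_complex.
have -> : psum u = fun N => (series (fun n => complex.Re (u n.+1)) N)%:C +
    'i%C * (series (fun n => complex.Im (u n.+1)) N)%:C.
  apply/funext => N; rewrite psum_series /series/= !raddf_sum/= big_distrr -big_split/=.
  by apply: eq_bigr => n _; rewrite -complexE.
rewrite /ccvgn; apply: is_cvgD; first exact: lift.
by apply: is_cvgM; [exact: is_cvg_cst | exact: lift].
Qed.

(** Uniformity in [M] matters: [pprod_C_factor_tail] gives no control of its upper end. *)
Lemma psum_tail (v : nat -> R[i]) (e : R[i]) : ccvgn (psum v) -> 0 < e ->
  \forall N \near \oo, forall M, (N <= M)%N -> `|\sum_(N.+1 <= n < M.+1) v n| < e.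
Proof.
move=> /cvg_ex[l /cvgrPdist_lt vl] e0.
have [N0 _ N0P] := vl _ (divr_gt0 e0 (ltr0n _ 2)).
exists N0 => // N /= N0N M NM.
have -> : \sum_(N.+1 <= n < M.+1) v n = (l - psum v N) - (l - psum v M).
  by rewrite /psum [X in _ - (_ - X)](big_cat_nat (n := N.+1))//=; ring.
apply: le_lt_trans (ler_normB _ _) _; rewrite [e]splitr.
by apply: ltrD; apply: N0P => //=; exact: leq_trans NM.
Qed.

End AbsoluteConvergence.

Section AlphaBounds.
Variables (R : realType) (F : polyEulerProduct R).

Lemma euler_gamma_bounded : exists K : nat, forall p, prime p ->
  `|euler_gamma F p| <= K%:R.
Proof.
(* The size is the Euler degree d. Applying [norm_1Bprod_1B] with t = 1/p cancels the factor p in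
   gamma(p) and leaves 2^d - 1. *)
exists (2 ^ size (index_enum 'I_(euler_degree F)))%N => p pp.
have p0 : 0 < p%:R :> R[i] by rewrite ltr0n prime_gt0.
rewrite /euler_gamma (euler_factor1 F pp) -prodfV normrM normr_nat.
under eq_bigr do rewrite invrK.
have coef_le (j : 'I_(euler_degree F)) : `|euler_coef j p / p%:R| <= p%:R^-1.
  by rewrite normrM normfV normr_nat ler_piMl ?invr_ge0 ?(ltW p0)// euler_coef_le1.
have t01 : 0 <= (p%:R^-1 : R[i]) <= 1.
  by rewrite invr_ge0 (ltW p0)/= invf_le1// ler1n prime_gt0.
apply: le_trans (ler_wpM2l (ltW p0) (@norm_1Bprod_1B _ _ _ _ _ t01 coef_le)) _.
by rewrite mulrCA mulfV ?gt_eqF// mulr1 natrX gerBl.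
Qed.

(** With |gamma(p)| <= K, enlarge the product over primes to the product of 1 + K/n^2 over all n,
    then use 1 + t <= exp(t) and the bound 2 for the sum of 1/n^2. *)
Lemma psum_norm_alpha_bounded : exists B : R, forall N,
  psum (fun n => `|euler_alpha F n / n%:R ^+ 2|) N <= B%:C.
Proof.
have [K gK] := euler_gamma_bounded; exists (expR (K%:R * 2)) => N.
apply: le_trans (psum_norm_alpha_le F N) _.
apply: (@le_trans _ _ (\prod_(1 <= n < N.+1) (1 + K%:R * (n%:R ^+ 2)^-1))%:C).
  rewrite rmorph_prod /pprod big_mkcond big_nat_cond [leRHS]big_nat_cond.
  apply: ler_prod => n /andP[/andP[n0 _] _].
  have cE : (1 + K%:R * (n%:R ^+ 2)^-1 : R)%:C = 1 + K%:R * (n%:R ^+ 2)^-1.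
    by rewrite rmorphD rmorphM fmorphV rmorphXn !rmorph_nat.
  rewrite /= cE; case: ifP => [pn|_].
    rewrite addr_ge0//= lerD2l normrM normfV normrX normr_nat.
    by rewrite ler_wpM2r ?invr_ge0 ?exprn_ge0// gK.
  by rewrite ler01 lerDl mulr_ge0 ?invr_ge0 ?exprn_ge0.
rewrite lecR; apply: (@le_trans _ _ (\prod_(1 <= n < N.+1) expR (K%:R * (n%:R ^+ 2)^-1))).
  apply: ler_prod => n _; rewrite expR_ge1Dx andbT.
  by rewrite addr_ge0// mulr_ge0 ?invr_ge0 ?exprn_ge0.
by rewrite -expR_sum -big_distrr/= ler_expR ler_wpM2l// sum_inv_sqr_le.
Qed.

Lemma psum_alpha_sqr_cvg : ccvgn (psum (fun n => euler_alpha F n / n%:R ^+ 2)).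
Proof. by have [B] := psum_norm_alpha_bounded; exact: bounded_psum_norm_cvg. Qed.

(** Partial product and partial sum differ by at most a tail of the absolutely convergent series, so
    they share their limit. *)
Lemma pprod_C_factor_cvg :
  (pprod (euler_C_factor F) : nat -> R[i]^o) @ \oo -->
  (climn (psum (fun n => euler_alpha F n / n%:R ^+ 2)) : R[i]^o).
Proof.
set a := fun n => euler_alpha F n / n%:R ^+ 2.
have cabs : ccvgn (psum (fun n => `|a n|)).
  have [B aB] := psum_norm_alpha_bounded.
  apply: (@bounded_psum_norm_cvg _ _ B) => N; apply: le_trans (aB N).
  by rewrite /psum; under eq_bigr do rewrite normr_id.
rewrite -[climn _]add0r.
rewrite (_ : pprod _ = (fun N => (pprod (euler_C_factor F) N - psum a N) + psum a N)).
  apply: cvgD; last exact: psum_alpha_sqr_cvg.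
  apply/cvgrPdist_lt => e e0; apply: filterS (psum_tail cabs e0) => N HN.
  rewrite sub0r normrN; have [M NM] := pprod_C_factor_tail F N.
  move=> /le_lt_trans; apply; apply: le_lt_trans (HN M NM).
  by rewrite ger0_norm// sumr_ge0.
by apply/funext => N; rewrite subrK.
Qed.

End AlphaBounds.

End Convergence.

(** * The summatory function *)

Section Identity.
Local Open Scope classical_set_scope.
Variables (R : realType) (F : polyEulerProduct R).
Implicit Types x : R.

Lemma floor_divn x (d : nat) : 0 <= x -> (0 < d)%N ->
  Num.floor (x / d%:R) = (Num.truncn x %/ d)%:Z.
Proof.
move=> x0 d0; have d0R : 0 < d%:R :> R by rewrite ltr0n.
have /andP[mx xm] := truncn_itv x0; set m := Num.truncn x in mx xm *.
apply: floor_def; rewrite -(PoszD _ 1) addn1 -!pmulrn ler_pdivlMr// ltr_pdivrMr// -!natrM.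
apply/andP; split; first by apply: le_trans mx; rewrite ler_nat leq_divM.
by apply: lt_le_trans xm _; rewrite ler_nat -ltn_divLR.
Qed.

Lemma int_div_natr (m d : nat) : (0 < d)%N ->
  ((m%:R / d%:R : R) \is a Num.int) = (d %| m)%N.
Proof.
move=> d0; have dn0 : d%:R != 0 :> R by rewrite pnatr_eq0 -lt0n.
rewrite intrEge0 ?divr_ge0//; apply/natrP/idP => [[k /eqP]|dm].
  by rewrite -[k%:R]divr1 eqr_div ?oner_eq0// mulr1 -natrM eqr_nat => /eqP->;
    rewrite dvdn_mull.
by exists (m %/ d)%N; rewrite -{1}(divnK dm) natrM mulfK.
Qed.

Lemma summatory_term x (d : nat) : 0 <= x -> (0 < d)%N ->
  euler_alpha F d *
    ((Num.truncn x %/ d)%:R * ((Num.truncn x %/ d)%:R + 1) / 2) =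
  x%:C * f1_term F x d + 2^-1 * g1_term F x d
    + x%:C ^+ 2 / 2 * (euler_alpha F d / d%:R ^+ 2)
    + 2^-1 * (x%:C * (euler_alpha F d / d%:R) *+ ((x / d%:R) \is a Num.int)).
Proof.
move=> x0 d0; have dn0 : d%:R != 0 :> R[i] by rewrite pnatr_eq0 -lt0n.
have fr : (frac_part (x / d%:R))%:C = x%:C / d%:R - (Num.truncn x %/ d)%:R.
  by rewrite /frac_part floor_divn// rmorphB rmorph_int rmorphM fmorphV rmorph_nat.
(* The boolean multiplicity puts both cases of [sawtooth] in one formula: at an integer it subtracts
   the excess 1/2. *)
have saw : (sawtooth (x / d%:R))%:C = 2^-1 - (frac_part (x / d%:R))%:C
    - 2^-1 *+ ((x / d%:R) \is a Num.int).
  rewrite /sawtooth; case: ifPn => xd.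
    rewrite /frac_part; have /intrP[k ->] := xd; rewrite intrKfloor subrr.
    by rewrite rmorph0 subr0 mulr1n subrr.
  by rewrite rmorphB fmorphV rmorph_nat subr0.
have g1E (y : R) : (y * (y - 1))%:C = y%:C * (y%:C - 1).
  by rewrite rmorphM rmorphB rmorph1.
rewrite /f1_term /g1_term saw g1E fr.
by case: (x / d%:R \is a Num.int); rewrite ?mulr1n ?mulr0n; field.
Qed.

Lemma summatory_identity x (N : nat) : 1 <= x -> (Num.truncn x <= N)%N ->
  \sum_(1 <= n < (Num.truncn x).+1) euler_totient F n
    - 2^-1 * (euler_totient F (Num.truncn x) *+ (x \is a Num.nat)) =
  x%:C * psum (f1_term F x) N + 2^-1 * psum (g1_term F x) N
    + x%:C ^+ 2 / 2 * psum (fun n => euler_alpha F n / n%:R ^+ 2) N.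
Proof.
move=> x1 mN; have x0 : 0 <= x by exact: le_trans x1.
rewrite (sum_euler_totient F mN).
rewrite (eq_big_nat _ _ (F2 := fun d => x%:C * f1_term F x d + 2^-1 * g1_term F x d
    + x%:C ^+ 2 / 2 * (euler_alpha F d / d%:R ^+ 2)
    + 2^-1 * (x%:C * (euler_alpha F d / d%:R) *+ ((x / d%:R) \is a Num.int)))); last first.
  by move=> d /andP[d0 _]; exact: summatory_term.
rewrite !big_split /= -!big_distrr /= -[RHS]addr0 -[LHS]addrA; congr (_ + _).
rewrite -mulrBr (_ : _ - _ = 0) ?mulr0//; apply/eqP; rewrite subr_eq0; apply/eqP.
(* What remains is the correction. An integral x/d forces x to be an integer; for x = m it means
   that d divides m, and the sum of alpha(d) m/d over these d is phi(m, F). *)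
case: (boolP (x \is a Num.nat)) => [/natrP[m xm]|xn]; last first.
  rewrite mulr0n big_nat_cond big1// => d; rewrite andbT => /andP[d0 _].
  case: (boolP (x / d%:R \is a Num.int)) => // xk; move: xn.
  rewrite natrEint x0 andbT -(divfK (_ : d%:R != 0) x) ?pnatr_eq0 -?lt0n//.
  by rewrite rpredM// intr_nat.
move: mN; rewrite xm natrK mulr1n => mN.
have m0 : (0 < m)%N by rewrite -(ltr_nat R) -xm (lt_le_trans ltr01).
rewrite (@euler_totient_alpha _ _ m N) ?m0// [RHS]big_mkcond.
apply: eq_big_nat => d /andP[d0 _]; rewrite int_div_natr//.
case: (boolP (_ %| _)%N) => // dm; rewrite mulr1n rmorph_nat -{1}(divnK dm) natrM.
by rewrite mulrCA mulfK// pnatr_eq0 -lt0n.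
Qed.

(** * One-sided limits of E, and convergence of the series for f1 and g1 *)

Lemma lim_euler_E (G : set_system R) {FG : ProperFilter G} x (m : nat) :
  G `=>` nbhs x -> (\forall y \near G, Num.truncn y = m) ->
  lim ((euler_E F : R -> R[i]^o) y @[y --> G]) =
  \sum_(1 <= n < m.+1) euler_totient F n - euler_C F * x%:C ^+ 2.
Proof.
move=> Gx Gm; apply: (@cvg_lim R[i]^o) => //.
have h : ((\sum_(1 <= n < m.+1) euler_totient F n - euler_C F * y%:C ^+ 2 : R[i]^o)
    @[y --> G]) -->
    (\sum_(1 <= n < m.+1) euler_totient F n - euler_C F * x%:C ^+ 2 : R[i]^o).
  apply: cvg_trans (cvg_app _ Gx) _.
  apply: cvgB; first exact: cvg_cst.
  apply: cvgM; first exact: cvg_cst.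
  by apply: cvgM; exact: continuous_real_complex.
apply: cvg_trans h; apply: near_eq_cvg.
by apply: filterS Gm => y; rewrite /euler_E => ->.
Qed.

(** At an integer the left limit lacks the last totient and the right limit contains it, so their
    mean contains half of it. *)
Lemma euler_E2E x : 1 <= x ->
  euler_E2 F x = \sum_(1 <= n < (Num.truncn x).+1) euler_totient F n
    - 2^-1 * (euler_totient F (Num.truncn x) *+ (x \is a Num.nat))
    - euler_C F * x%:C ^+ 2.
Proof.
move=> x1; rewrite /euler_E2; case: (boolP (x \is a Num.nat)) => [/natrP[m xm]|_]; last first.
  by rewrite mulr0n mulr0 subr0.
case: m xm => [|m] xm; first by move: x1; rewrite xm ler10.
rewrite xm natrK mulr1n /lim_left /lim_right.
rewrite (@lim_euler_E _ _ m.+1%:R m); first last.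
- near=> y; apply: truncn_def; apply/andP; split; near: y; last exact: nbhs_left_lt.
  by apply: nbhs_left_ge; rewrite ltr_nat.
- exact: cvg_within.
rewrite (@lim_euler_E _ _ m.+1%:R m.+1); first last.
- near=> y; apply: truncn_def; apply/andP; split; near: y; first exact: nbhs_right_ge.
  by apply: nbhs_right_lt; rewrite ltr_nat.
- exact: cvg_within.
by rewrite !(big_nat_recr m.+1)//=; field.
Unshelve. all: by end_near. Qed.

(* Beyond [x] the terms of [f1] and [g1] are of this form, since then
   [{x / n} = x / n]. *)
Lemma psum_eventually_comb_cvg (u : nat -> R[i]) (m : nat) (b c : R[i]) :
  ccvgn (psum (fun n => euler_alpha F n / n%:R)) ->
  (forall n, (m < n)%N -> u n = b * (euler_alpha F n / n%:R)
                              + c * (euler_alpha F n / n%:R ^+ 2)) ->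
  ccvgn (psum u).
Proof.
move=> c1 uE; set v1 := fun n => _ in c1; set v2 := fun n => euler_alpha F n / n%:R ^+ 2.
have c2 : ccvgn (psum v2) by exact: psum_alpha_sqr_cvg.
(* The last summand, constant in [N], corrects the finitely many terms up to [m], where [u] is
   arbitrary. *)
have h : cvgn ((fun N => b * psum v1 N + c * psum v2 N
    + psum (fun n => u n - (b * v1 n + c * v2 n)) m) : nat -> R[i]^o).
  apply: is_cvgD; last exact: is_cvg_cst.
  by apply: is_cvgD; (apply: is_cvgM; first exact: is_cvg_cst); [exact: c1 | exact: c2].
move: h => /cvg_ex[l h]; apply/cvg_ex; exists l; apply: cvg_trans h.
apply: near_eq_cvg; exists m => // N /= mN.
rewrite /psum !big_distrr/= -big_split/=.
rewrite !(big_cat_nat (m := 1%N) (n := m.+1) (p := N.+1))//= sumrB.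
rewrite [X in _ = _ + X](eq_big_nat _ _ (F2 := fun n => b * v1 n + c * v2 n)); last first.
  by move=> n /andP[mn _]; exact: uE.
by ring.
Qed.

Lemma frac_part_small x (n : nat) : 1 <= x -> (Num.truncn x < n)%N ->
  frac_part (x / n%:R) = x / n%:R /\ sawtooth (x / n%:R) = 2^-1 - x / n%:R.
Proof.
move=> x1 xn; have n0 : (0 < n)%N by exact: leq_trans xn.
have x0 : 0 < x by exact: lt_le_trans x1.
have fl : Num.floor (x / n%:R) = 0 by rewrite floor_divn ?ltW// divn_small.
have fr : frac_part (x / n%:R) = x / n%:R by rewrite /frac_part fl subr0.
(* An integer with floor 0 is 0, whereas x/n > 0; the exceptional value of [sawtooth] cannot
   occur. *)
split=> //; rewrite /sawtooth fr; case: ifPn => // /intrP[k xk].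
have : 0 < x / n%:R by rewrite divr_gt0// ltr0n.
by move: fl; rewrite xk intrKfloor => ->; rewrite ltxx.
Qed.

End Identity.

(** The convergence claims certify that [climn] returns genuine limits in C(F), f1 and g1, not
    default values. *)
Theorem theorem2p2 (R : realType) (F : polyEulerProduct R)
    (alpha_cvg : ccvgn (psum (fun n => euler_alpha F n / n%:R)))
    (x : R) (x_ge1 : 1 <= x) :
  [/\ ccvgn (pprod (euler_C_factor F)),
      ccvgn (psum (f1_term F x)),
      ccvgn (psum (g1_term F x)) &
      euler_E2 F x = x%:C * euler_f1 F x + 2^-1 * euler_g1 F x].
Proof.
have Ccvg := pprod_C_factor_cvg (F := F).
have n0 n : (Num.truncn x < n)%N -> n%:R != 0 :> R[i].
  by rewrite pnatr_eq0; case: n.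
have f1cvg : ccvgn (psum (f1_term F x)).
  apply: (psum_eventually_comb_cvg (m := Num.truncn x) (b := 2^-1) (c := - x%:C) alpha_cvg).
  move=> n xn; rewrite /f1_term (frac_part_small x_ge1 xn).2.
  by rewrite rmorphB fmorphV rmorphM fmorphV !rmorph_nat; field; exact: n0 xn.
have g1cvg : ccvgn (psum (g1_term F x)).
  apply: (psum_eventually_comb_cvg (m := Num.truncn x) (b := - x%:C)
    (c := x%:C ^+ 2) alpha_cvg).
  move=> n xn; rewrite /g1_term (frac_part_small x_ge1 xn).1.
  by rewrite rmorphM rmorphB rmorphM fmorphV rmorph1 rmorph_nat; field; exact: n0 xn.
split; [by apply/cvg_ex; eexists; exact: Ccvg | exact: f1cvg | exact: g1cvg |].
have Climn : climn (pprod (euler_C_factor F)) =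
    climn (psum (fun n => euler_alpha F n / n%:R ^+ 2)).
  exact: (cvg_lim (@norm_hausdorff _ R[i]^o) Ccvg).
rewrite (euler_E2E F x_ge1) /euler_C Climn.
set L := climn (psum _); apply/eqP; rewrite subr_eq; apply/eqP.
pose T (N : nat) : R[i] := x%:C * psum (f1_term F x) N + 2^-1 * psum (g1_term F x) N
  + x%:C ^+ 2 / 2 * psum (fun n => euler_alpha F n / n%:R ^+ 2) N.
have Tlim : ((T : nat -> R[i]^o) @ \oo -->
    (x%:C * euler_f1 F x + 2^-1 * euler_g1 F x + x%:C ^+ 2 / 2 * L : R[i]^o))%classic.
  apply: cvgD; last by apply: cvgM; [exact: cvg_cst | exact: psum_alpha_sqr_cvg].
  by apply: cvgD; (apply: cvgM; first exact: cvg_cst); [exact: f1cvg | exact: g1cvg].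
have -> : x%:C * euler_f1 F x + 2^-1 * euler_g1 F x + 2^-1 * L * x%:C ^+ 2
  = x%:C * euler_f1 F x + 2^-1 * euler_g1 F x + x%:C ^+ 2 / 2 * L by ring.
(* By [summatory_identity], [T] is constant from [x] on, so its limit is that constant. *)
apply: (cvg_unique (@norm_hausdorff _ R[i]^o) _ Tlim).
apply: cvg_near_cst; exists (Num.truncn x) => // N /= xN.
exact/esym/summatory_identity.
Qed.
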